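(* For all $\mathcal{X},\mathcal{Y},\mathcal{Z}\in\mathbf{SSS}$ (with no hypothesis on any of the three spaces) the product of Markov kernels $$\otimes:\ \mathsf{P}(\mathcal{X})^{\mathcal{Y}\times\mathcal{Z}}\times\mathsf{P}(\mathcal{Y})^{\mathcal{Z}}\longrightarrow\mathsf{P}(\mathcal{X}\times\mathcal{Y})^{\mathcal{Z}},$$ given on points by $$(K\otimes Q)(z)=\mathbb{M}\Bigl(\bigl(y\mapsto K(y,z)\otimes\delta_y\bigr)_*Q(z)\Bigr),$$ is sample-smooth.
   Context: **Sample space.** $\Omega=[0,1]^{\mathbb{N}}$; $\mathcal{B}_\Omega$ is the universal completion of its Borel (product) $\sigma$-algebra, i.e. all universally measurable subsets; $\Omega^\Omega$ is the set of all $\mathcal{B}_\Omega$-$\mathcal{B}_\Omega$-measurable self-maps of $\Omega$; $\mathsf{P}_\Omega$ is the set of all probability measures on $\mathcal{B}_\Omega$; $U=\bigotimes_{n}U[0,1]$ is the uniform measure. $\Theta=(\Theta_1,\Theta_2):\Omega\to\Omega\times\Omega$ is the Borel isomorphism de-interleaving the coordinates of a sequence (e.g. even- and odd-indexed coordinates); $\Theta_*U=U\otimes U$. **Site.** $\Omega_n:=\mathbb{R}^n\times\Omega$, $n\ge0$ ($\Omega_0=\Omega$). A map $g:\Omega_m\to\mathbb{R}^n$ is mixed-smooth, $g\in\mathcal{C}^\infty_{\mathrm{mix}}(\Omega_m,\mathbb{R}^n)$, if (M1) $g(-,\omega)\in C^\infty(\mathbb{R}^m,\mathbb{R}^n)$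 for every $\omega$, and (M2) $g(t,-)$ is $\mathcal{B}_\Omega$-Borel measurable for every $t$. The category $\mathbb{S}$ has objects $\Omega_n$ and morphisms $\mathbb{S}(\Omega_m,\Omega_n)=\{(g,\Phi): g\in\mathcal{C}^\infty_{\mathrm{mix}}(\Omega_m,\mathbb{R}^n),\Phi\in\Omega^\Omega\}$, where $(g,\Phi)(t,\omega)=(g(t,\omega),\Phi(\omega))$. **Sample-smooth spaces.** A sample-smooth space is a set $\mathcal{X}$ with, for each $n\ge0$, a set $\mathcal{X}^{\Omega_n}$ of maps $\Omega_n\to\mathcal{X}$ (plots) containing all constant maps and such that $p\in\mathcal{X}^{\Omega_n}$, $h\in\mathbb{S}(\Omega_m,\Omega_n)$ imply $p\circ h\in\mathcal{X}^{\Omega_m}$. A map $f:\mathcal{X}\to\mathcal{Y}$ is sample-smooth (a morphism of $\mathbf{SSS}$) if $f\circ p\in\mathcal{Y}^{\Omega_n}$ for all $n$ and $p\in\mathcal{X}^{\Omega_n}$. Write $\mathcal{X}^\Omega:=\mathcal{X}^{\Omega_0}$. Products: $(\prod_i\mathcal{X}_i)^{\Omega_n}=\prod_i\mathcal{X}_i^{\Omega_n}$. The function space $\mathcal{Y}^{\mathcal{X}}$ is $\mathbf{SSS}(\mathcal{X},\mathcal{Y})$ with plots those $F:\Omega_n\to\mathcal{Y}^{\mathcal{X}}$ such that for all $m$, $h\in\mathbb{S}(\Omega_m,\Omega_n)$, $q\in\mathcal{X}^{\Omega_m}$ one has $(u\mapsto F(h(u))(q(u)))\in\mathcal{Y}^{\Omega_m}$.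 The induced $\sigma$-algebra is $\mathcal{B}_{\mathcal{X}}:=\{A\subseteq\mathcal{X}: X^{-1}(A)\in\mathcal{B}_\Omega\ \forall X\in\mathcal{X}^\Omega\}$. **Space of measures.** $\mathsf{P}(\mathcal{X}):=\{X_*P: X\in\mathcal{X}^\Omega, P\in\mathsf{P}_\Omega\}$, a set of probability measures on $(\mathcal{X},\mathcal{B}_{\mathcal{X}})$, with plots $\mathsf{P}(\mathcal{X})^{\Omega_n}:=\{\mathsf{L}Y: Y\in\mathcal{X}^{\Omega_n}\}$, $\mathsf{L}Y(t,\omega):=(\omega'\mapsto Y(t,\Theta^{-1}(\omega,\omega')))_*U$. $\mathbb{M}_{\mathcal{X}}:\mathsf{P}(\mathsf{P}(\mathcal{X}))\to\mathsf{P}(\mathcal{X})$ is $\mathbb{M}_{\mathcal{X}}(\Gamma)=\int\nu\,\Gamma(d\nu)$; $\delta_y$ is the Dirac measure. For $\mu\in\mathsf{P}(\mathcal{X})$, $\nu\in\mathsf{P}(\mathcal{Y})$ the product $\mu\otimes\nu\in\mathsf{P}(\mathcal{X}\times\mathcal{Y})$ is defined on all of $\mathcal{B}_{\mathcal{X}\times\mathcal{Y}}$ by $(\mu\otimes\nu)(C)=\int\!\int \mathbf{1}[(X(\omega_1),Y(\omega_2))\in C]\,U(d\omega_2)U(d\omega_1)$ for any $X\in\mathcal{X}^\Omega$, $Y\in\mathcal{Y}^\Omega$ with $X_*U=\mu$, $Y_*U=\nu$ (such exist, and the value does not depend on the choice). *)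

(* Defs.v *)
From HB Require Import structures.
From mathcomp Require Import all_boot all_order all_algebra.
From mathcomp Require Import all_classical all_reals all_analysis.
Set Implicit Arguments.
Unset Strict Implicit.
Unset Printing Implicit Defensive.
Import Order.TTheory GRing.Theory Num.Theory numFieldNormedType.Exports.
Local Open Scope classical_set_scope.
Local Open Scope ring_scope.

Section sample_space.
Variable R : realType.

Definition cube : Type := nat -> {i01 R}.
HB.instance Definition _ := gen_eqMixin cube.
HB.instance Definition _ := gen_choiceMixin cube.
HB.instance Definition _ := isPointed.Build cube (fun=> 0%:i01).

Definition coord_sets : set (set cube) :=
  [set A | exists n (B : set R), measurable B /\ A = [set w | B (w n)%:num]].

(* The cube with its Borel (product) sigma-algebra. *)
Definition borel_cube : Type := g_sigma_algebraType coord_sets.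
HB.instance Definition _ := Measurable.on borel_cube.

(* A lies in the mu-completion of the Borel sigma-algebra for every Borel
   probability measure mu. *)
Definition univ_measurable (A : set cube) : Prop :=
  forall mu : probability borel_cube R, exists B C : set borel_cube,
    [/\ measurable B, measurable C, B `<=` A, A `<=` C & mu (C `\` B) = 0%E].

Lemma univ_measurable0 : univ_measurable set0.
Proof. by move=> mu; exists set0, set0; split; rewrite ?setD0 ?measure0. Qed.

Lemma univ_measurableC A : univ_measurable A -> univ_measurable (~` A).
Proof.
move=> mA mu; have [B [C [mB mC BA AC muBC]]] := mA mu.
exists (~` C), (~` B); split; try exact: measurableC.
- exact: subsetC.
- exact: subsetC.
- by rewrite setDE setCK setIC -setDE.
Qed.

Lemma univ_measurable_bigcup (F : (set cube)^nat) :
  (forall i, univ_measurable (F i)) -> univ_measurable (\bigcup_i F i).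
Proof.
move=> mF mu.
have /choice [BC BCP] : forall i, exists BC : set borel_cube * set borel_cube,
    [/\ measurable BC.1, measurable BC.2, BC.1 `<=` F i, F i `<=` BC.2 &
        mu (BC.2 `\` BC.1) = 0%E].
  by move=> i; have [B [C ?]] := mF i mu; exists (B, C).
have mB : measurable (\bigcup_i (BC i).1).
  by apply: bigcup_measurable => i _; case: (BCP i).
have mC : measurable (\bigcup_i (BC i).2).
  by apply: bigcup_measurable => i _; case: (BCP i).
exists (\bigcup_i (BC i).1), (\bigcup_i (BC i).2); split => //.
- by apply: subset_bigcup => i _; case: (BCP i).
- by apply: subset_bigcup => i _; case: (BCP i).
have mD : measurable (\bigcup_i ((BC i).2 `\` (BC i).1)).
  by apply: bigcup_measurable => i _; case: (BCP i) => *; exact: measurableD.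
have [N [mN N0 DN]] : mu.-negligible (\bigcup_i ((BC i).2 `\` (BC i).1)).
  apply: negligible_bigcup => i; case: (BCP i) => ? ? _ _ D0.
  by apply/negligibleP => //; exact: measurableD.
apply: (@subset_measure0 _ _ _ mu _ N) => //; first exact: measurableD.
apply: subset_trans DN => x [[i _ Ci] nB]; exists i => //; split => // Bi.
by apply: nB; exists i.
Qed.

Definition univ_display : measure_display.
Proof. by constructor. Qed.

Definition Omega : Type := cube.
HB.instance Definition _ := Pointed.on Omega.
HB.instance Definition _ := @isMeasurable.Build univ_display Omega
  univ_measurable univ_measurable0 univ_measurableC univ_measurable_bigcup.

(* These values on finite-dimensional rectangles determine U on the Borel sets,
   hence on all universally measurable sets. *)
Definition is_uniform (U : probability Omega R) : Prop :=
  forall (n : nat) (A : nat -> set R), (forall i, measurable (A i)) ->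
  U [set w : Omega | forall i, (i < n)%N -> A i (w i)%:num] =
  (\prod_(i < n) uniform_prob (@ltr01 R) (A i))%E.

Definition theta1 (w : Omega) : Omega := fun n => w n.*2.
Definition theta2 (w : Omega) : Omega := fun n => w n.*2.+1.
Definition theta (w : Omega) : Omega * Omega := (theta1 w, theta2 w).
Definition theta_inv (w w' : Omega) : Omega :=
  fun n => if odd n then w' n./2 else w n./2.

Lemma thetaK w : theta_inv (theta w).1 (theta w).2 = w.
Proof.
apply/funext => n; rewrite /theta_inv /theta /= /theta1 /theta2.
by case: ifP => on; rewrite -[in RHS](odd_double_half n) on.
Qed.

Lemma theta_invK w w' : theta (theta_inv w w') = (w, w').
Proof.
congr (_, _); apply/funext => n; rewrite /theta1 /theta2 /theta_inv /=.
- by rewrite odd_double doubleK.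
- by rewrite odd_double /= uphalf_double.
Qed.

End sample_space.

Section site.
Variable R : realType.

(* C^k: all iterated partial derivatives of order <= k exist and are
   continuous. *)
Fixpoint Ck (m n k : nat) (f : 'rV[R]_m -> 'rV[R]_n) : Prop :=
  continuous f /\
  if k is k'.+1 then
    forall i : 'I_m, (forall x, derivable f x (delta_mx 0 i)) /\
                     Ck k' (fun x => 'D_(delta_mx 0 i) f x)
  else True.

Definition smooth (m n : nat) (f : 'rV[R]_m -> 'rV[R]_n) : Prop :=
  forall k, Ck k f.

Definition Omegan (n : nat) : Type := 'rV[R]_n * Omega R.

Definition mixed_smooth (m n : nat) (g : Omegan m -> 'rV[R]_n) : Prop :=
  (forall w, smooth (fun t => g (t, w))) /\
  (forall t (B : set 'rV[R]_n), <<s [set O | open O] >> B ->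
     measurable [set w : Omega R | B (g (t, w))]).

Definition site_mor (m n : nat) : set (Omegan m -> Omegan n) :=
  [set h | exists (g : Omegan m -> 'rV[R]_n) (Phi : Omega R -> Omega R),
    [/\ mixed_smooth g, measurable_fun setT Phi &
        h = fun u => (g u, Phi u.2)]].

End site.

(* The bare data of a space, without the two closure axioms of [SSS]. Products,
   function spaces, spaces of measures and sample-smoothness only involve the
   data. *)
Record pre_space (R : realType) := Space {
  carrier :> Type ;
  plot : forall n, set (Omegan R n -> carrier) }.
Arguments plot {R} p {n} _ : rename.

Record SSS (R : realType) := MkSSS {
  space_of :> pre_space R ;
  plot_cst : forall n (x : space_of), plot space_of (fun _ : Omegan R n => x) ;
  plot_comp : forall m n (p : Omegan R n -> space_of)
    (h : Omegan R m -> Omegan R n),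
    plot space_of p -> site_mor h -> plot space_of (p \o h) }.

Section spaces.
Variable R : realType.
Implicit Types X Y : pre_space R.

Definition sample_smooth X Y (f : X -> Y) : Prop :=
  forall n (p : Omegan R n -> X), plot X p -> plot Y (f \o p).

Definition prod_space X Y : pre_space R :=
  {| carrier := X * Y ;
     plot := fun n => [set p | plot X (fst \o p) /\ plot Y (snd \o p)] |}.

Definition smooth_map X Y : Type := {f : X -> Y | sample_smooth f}.

Definition smooth_map_fun X Y (f : smooth_map X Y) : X -> Y := sval f.
Coercion smooth_map_fun : smooth_map >-> Funclass.

Definition fun_space X Y : pre_space R :=
  {| carrier := smooth_map X Y ;
     plot := fun n => [set F : Omegan R n -> smooth_map X Y |
       forall m (h : Omegan R m -> Omegan R n) (q : Omegan R m -> X),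
         site_mor h -> plot X q -> plot Y (fun u => F (h u) (q u))] |}.

(* X^Omega, identifying Omega_0 = R^0 x Omega with Omega. *)
Definition rand X : set (Omega R -> X) :=
  [set a | plot X (fun u : Omegan R 0 => a u.2)].
Arguments rand X _ : clear implicits.

Definition Bsets X : set (set X) :=
  [set A | forall a, rand X a -> measurable (a @^-1` A)].
Arguments Bsets X _ : clear implicits.

Lemma Bsets0 X : Bsets X set0.
Proof. by move=> a _; rewrite preimage_set0. Qed.

Lemma BsetsC X A : Bsets X A -> Bsets X (~` A).
Proof. by move=> mA a Xa; rewrite preimage_setC; exact/measurableC/mA. Qed.

Lemma Bsets_bigcup X (F : (set X)^nat) :
  (forall i, Bsets X (F i)) -> Bsets X (\bigcup_i F i).
Proof.
move=> mF a Xa; rewrite preimage_bigcup.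
by apply: bigcup_measurable => i _; exact: mF.
Qed.

(* X with the sigma-algebra [Bsets X]. A measurableType must be pointed whereas
   X may be empty, hence the parameter x0; it has no influence on measurable
   sets or integrals. *)
Definition at_point X (x0 : X) : Type := X.

Definition Bsets_display : measure_display.
Proof. by constructor. Qed.

Section at_point.
Variables (X : pre_space R) (x0 : X).
HB.instance Definition _ := gen_eqMixin (at_point x0).
HB.instance Definition _ := gen_choiceMixin (at_point x0).
HB.instance Definition _ := isPointed.Build (at_point x0) x0.
HB.instance Definition _ := @isMeasurable.Build Bsets_display (at_point x0)
  (@Bsets X) (@Bsets0 X) (@BsetsC X) (@Bsets_bigcup X).
End at_point.

(* Measures on [Bsets X] are encoded as functions on all subsets of X that
   vanish outside [Bsets X], so that Leibniz equality is equality on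
   [Bsets X]. *)
Definition onB X (mu : set X -> \bar R) : set X -> \bar R :=
  fun A => if `[< Bsets X A >] then mu A else 0%E.

Definition image_meas X Y (mu : set X -> \bar R) (f : X -> Y) :
    set Y -> \bar R :=
  onB (fun A => mu (f @^-1` A)).

Definition law X (P : probability (Omega R) R) (a : Omega R -> X) :
    set X -> \bar R :=
  onB (fun A => P (a @^-1` A)).

Definition prob_on X : Type :=
  {mu : set X -> \bar R |
    exists a (P : probability (Omega R) R), rand X a /\ mu = law P a}.

Definition prob_val X (mu : prob_on X) : set X -> \bar R := sval mu.
Coercion prob_val : prob_on >-> Funclass.

Section with_uniform.
Variable U : probability (Omega R) R.

Definition P_space X : pre_space R :=
  {| carrier := prob_on X ;
     plot := fun n => [set p : Omegan R n -> prob_on X |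
       exists2 Y : Omegan R n -> X, plot X Y &
         forall t w, p (t, w) = law U (fun w' => Y (t, theta_inv w w'))
                     :> (set X -> \bar R)] |}.

Lemma dirac_subproof (Y : SSS R) (y : Y) :
  exists a (P : probability (Omega R) R),
    rand Y a /\ onB (fun A : set Y => (\1_A y)%:E) = law P a.
Proof.
exists (fun=> y), U; split; first exact: plot_cst.
apply/funext => A; rewrite /law /onB; case: ifP => // _.
rewrite indicE; case: (boolP (y \in A)) => [/set_mem Ay|/negP nAy].
  rewrite (_ : _ @^-1` A = setT) ?probability_setT//.
  by apply/seteqP; split.
rewrite (_ : _ @^-1` A = set0) ?measure0//.
by apply/seteqP; split => // w /= Ay; apply: nAy; exact/mem_set.
Qed.

Definition dirac_at (Y : SSS R) (y : Y) : P_space Y :=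
  exist _ _ (dirac_subproof y).

(* rho = mu (x) nu; the clauses state that representatives exist and that the
   defining formula holds for all of them. *)
Definition is_product X Y (mu : P_space X) (nu : P_space Y)
    (rho : P_space (prod_space X Y)) : Prop :=
  let represents a b := [/\ rand X a, rand Y b,
    prob_val mu = law U a & prob_val nu = law U b] in
  (exists a b, represents a b) /\
  (forall a b, represents a b ->
   forall C : set (prod_space X Y), Bsets _ C ->
     prob_val rho C = (\int[U]_w1 \int[U]_w2 (\1_C (a w1, b w2))%:E)%E).

Definition prob_point X (Gamma : prob_on X) : X := sval (cid (svalP Gamma)) point.

(* The intensity measure C |-> \int nu(C) Gamma(d nu). *)
Definition mean X (Gamma : P_space (P_space X)) : set X -> \bar R :=
  let G : set (at_point (prob_point Gamma)) -> \bar R := prob_val Gamma in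
  onB (fun C : set X => (\int[G]_nu prob_val (nu : prob_on X) C)%E).

(* rho = M((y |-> K(y,z) (x) delta_y)_* Q(z)), with g the map being pushed
   forward along and Gamma the resulting element of P(P(X x Y)). *)
Definition kernel_product_at X (Y Z : SSS R)
    (K : smooth_map (prod_space Y Z) (P_space X)) (Q : smooth_map Z (P_space Y))
    (z : Z) (rho : P_space (prod_space X Y)) : Prop :=
  exists (g : Y -> P_space (prod_space X Y))
         (Gamma : P_space (P_space (prod_space X Y))),
  [/\ forall y : Y, is_product (K (y, z)) (dirac_at y) (g y),
      prob_val Gamma = image_meas (prob_val (Q z)) g &
      prob_val rho = mean Gamma].

End with_uniform.
End spaces.
Arguments rand {R} X _.
Arguments Bsets {R} X _.

(* Main.v *)
Require Import Defs.
From HB Require Import structures.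
From mathcomp Require Import all_boot all_order all_algebra.
From mathcomp Require Import all_classical all_reals all_analysis.
From mathcomp Require Import measurable_realfun.

Set Implicit Arguments.
Unset Strict Implicit.
Unset Printing Implicit Defensive.
Import Order.TTheory GRing.Theory Num.Theory numFieldNormedType.Exports.
Local Open Scope classical_set_scope.
Local Open Scope ring_scope.

(** The product of kernels is sample-smooth because it can be sampled from: a
    uniform point of the cube carries, through its even and odd coordinates, two
    independent uniform points, so that randomness can be split as often as
    needed.

    Fix [z], let [Q z] be the law of [b] under [U], and suppose that [K (b w, z)]
    is the law of [w' |-> T (theta_inv w w')]. Sampling the pair consists in
    drawing [w], setting [y := b w], and then drawing from [K (y, z)] with fresh
    randomness [w']. With [v := theta_inv w w'] this is the random pair
    [v |-> (T v, b (theta1 v))], so the product at [z] should be its law under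
    [U] ([mean_kernel_image]). The formula is stable under parameters: when [Q],
    [K] and [z] vary along plots, [b] and [T] are supplied by plots of [Y] and
    [X], and the pairs form a plot of the product space after re-indexing the
    coordinates of the sample point ([plot_kernel_product]). The other half of
    the statement, that the values are those of the defining formula, follows
    from the same computation, because the product of a law with a point mass is
    the law of a section ([is_product_dirac]).

    The analytic content is the disintegration
    [U A = \int[U]_w U (theta_inv w @^-1` A)] for every universally measurable
    [A] ([uniform_disintegration]), together with the universal measurability of
    the integrand ([measurable_section]). On Borel sets this is Tonelli's theorem
    and the fact that interleaving two independent uniform points gives a uniform
    point, which is checked on rectangles ([uniform_interleave]). A universally
    measurable set is bracketed by two Borel sets whose difference has almost
    only null sections ([univ_section_bracket]), which transfers both facts to
    it. The mean of a random law is then obtained by a change of variables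
    ([mean_law]). *)

(** * Images of probability measures *)

Section image_prob.
Context d d' (T : measurableType d) (T' : measurableType d') (R : realType).
Variables (P : probability T R) (f : T -> T') (mf : measurable_fun setT f).

Let f_mixin := isMeasurableFun.Build _ _ _ _ _ mf.
Let f_pack : {mfun T >-> T'} := HB.pack f f_mixin.

Definition image_prob : probability T' R := distribution P f_pack.

Lemma image_probE A : image_prob A = P (f @^-1` A).
Proof. by []. Qed.

Lemma ge0_integral_image_prob (g : T' -> \bar R) :
  measurable_fun setT g -> (forall y, 0 <= g y)%E ->
  (\int[image_prob]_y g y = \int[P]_x g (f x))%E.
Proof. by move=> mg g0; rewrite ge0_integral_distribution. Qed.

End image_prob.

Section product_prob.
Context d1 d2 (T1 : measurableType d1) (T2 : measurableType d2) (R : realType).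
Variables (P : probability T1 R) (Q : probability T2 R).

Let prod : set (T1 * T2) -> \bar R := (P \x Q)%E.

HB.instance Definition _ := Measure.on prod.

Let prod_setT : prod setT = 1%E.
Proof.
by rewrite -setXTT [LHS]product_measure1E//= !probability_setT mule1.
Qed.

HB.instance Definition _ := Measure_isProbability.Build _ _ _ prod prod_setT.

Definition product_prob : probability (T1 * T2)%type R := prod.

End product_prob.

(** * Borel and universally measurable subsets of the cube *)

Section cube_measurability.
Variable R : realType.

Lemma measurable_coord (n : nat) (B : set R) : measurable B ->
  measurable [set w : borel_cube R | B (w n)%:num].
Proof. by move=> mB; apply: sub_sigma_algebra; exists n, B. Qed.

Lemma measurable_fun_cube d (T : measurableType d) (f : T -> borel_cube R) :
  (forall n (B : set R), measurable B -> measurable [set x | B (f x n)%:num]) ->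
  measurable_fun setT f.
Proof.
move=> mf; apply: (@measurability _ _ _ (borel_cube R) _ _ (@coord_sets R)) =>// _ [_ [n [B [mB ->]]] <-].
by rewrite setTI; exact: mf.
Qed.

Lemma measurable_OmegaE (A : set (Omega R)) :
  measurable A = univ_measurable A.
Proof. by []. Qed.

Lemma measurable_univ_borel :
  measurable_fun setT (id : Omega R -> borel_cube R).
Proof.
move=> _ A mA; rewrite setTI preimage_id measurable_OmegaE => mu.
by exists A, A; split => //; rewrite setDv measure0.
Qed.

(** A Borel map is measurable for the universally measurable sets: a bracket of
    [A] for the image measure under [f] pulls back to a bracket of
    [f @^-1` A]. *)
Lemma borel_measurable_univ (f : borel_cube R -> borel_cube R) :
  measurable_fun setT f -> measurable_fun setT (f : Omega R -> Omega R).
Proof.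
move=> mf _ A; rewrite setTI !measurable_OmegaE => mA mu.
have [B [C [mB mC BA AC CB0]]] := mA (image_prob mu mf).
exists (f @^-1` B), (f @^-1` C); split.
- by rewrite -[X in measurable X]setTI; exact: (mf measurableT).
- by rewrite -[X in measurable X]setTI; exact: (mf measurableT).
- exact: preimage_subset.
- exact: preimage_subset.
- exact: CB0.
Qed.

Lemma measurable_reindex (s : nat -> nat) :
  measurable_fun setT (fun w : Omega R => (fun n => w (s n)) : Omega R).
Proof.
apply: borel_measurable_univ; apply: measurable_fun_cube => n B mB.
exact: measurable_coord.
Qed.

Lemma measurable_theta1 : measurable_fun setT (@theta1 R).
Proof. exact: measurable_reindex. Qed.

Lemma measurable_theta_inv_pair :
  measurable_fun setT (fun w : borel_cube R * borel_cube R =>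
                         theta_inv w.1 w.2 : borel_cube R).
Proof.
apply: measurable_fun_cube => n B mB; rewrite /theta_inv.
case: (odd n).
- rewrite (_ : mkset _ = snd @^-1` [set w : borel_cube R | B (w n./2)%:num])//.
  rewrite -[X in measurable X]setTI.
  by apply: measurable_snd => //; exact: measurable_coord.
- rewrite (_ : mkset _ = fst @^-1` [set w : borel_cube R | B (w n./2)%:num])//.
  rewrite -[X in measurable X]setTI.
  by apply: measurable_fst => //; exact: measurable_coord.
Qed.

Lemma measurable_theta_inv (w : Omega R) :
  measurable_fun setT (theta_inv w : Omega R -> Omega R).
Proof.
apply: borel_measurable_univ.
have mpair : measurable_fun setT
    (fun w' : borel_cube R => (w : borel_cube R, w')) by exact: measurable_pair1.
exact: (measurableT_comp measurable_theta_inv_pair mpair).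
Qed.

End cube_measurability.

(** * The interleaving of two uniform points is uniform *)

Section uniform_interleaving.
Variable R : realType.

Definition rect (n : nat) (A : nat -> set R) : set (borel_cube R) :=
  [set w | forall i, (i < n)%N -> A i (w i)%:num].

Definition rects : set (set (borel_cube R)) :=
  [set E | exists n A, (forall i, measurable (A i)) /\ E = rect n A].

Lemma measurable_rect n A : (forall i, measurable (A i)) ->
  measurable (rect n A).
Proof.
move=> mA.
rewrite (_ : rect n A =
    \bigcap_(i in `I_n) [set w : borel_cube R | A i (w i)%:num]); last first.
  by apply/seteqP; split => w wA i; exact: wA.
by apply: bigcap_measurableType => i _; exact: measurable_coord.
Qed.

Lemma rect_widen m n A : (n <= m)%N ->
  rect n A = rect m (fun i => if (i < n)%N then A i else setT).
Proof.
move=> nm; apply/seteqP; split => w wA i im /=.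
- by case: ifPn => // /wA.
- by have /= := wA i (leq_trans im nm); rewrite im.
Qed.

Lemma rects_setI : setI_closed rects.
Proof.
move=> _ _ [n [A [mA ->]]] [m [B [mB ->]]].
pose trunc k (C : nat -> set R) i := if (i < k)%N then C i else setT.
exists (maxn n m), (fun i => trunc n A i `&` trunc m B i); split.
  by move=> i; rewrite /trunc; apply: measurableI; case: ifP.
rewrite (rect_widen A (leq_maxl n m)) (rect_widen B (leq_maxr n m)).
apply/seteqP; split => w.
- by move=> [wA wB] i im; split; [exact: wA|exact: wB].
- by move=> wAB; split => i im; have [] := wAB i im.
Qed.

Lemma measurable_rectsE : @measurable _ (borel_cube R) = <<s rects >>.
Proof.
apply/seteqP; split.
- apply: smallest_sub; first exact: smallest_sigma_algebra.
  move=> _ [n [B [mB ->]]]; apply: sub_sigma_algebra.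
  exists n.+1, (fun i => if i == n then B else setT); split.
    by move=> i; case: ifP.
  apply/seteqP; split => w /=.
  + by move=> wB i _; case: eqP => // ->.
  + by move=> /(_ n (ltnSn n)); rewrite eqxx.
- apply: smallest_sub; first exact: sigma_algebra_measurable.
  by move=> _ [n [A [mA ->]]]; exact: measurable_rect.
Qed.

Lemma prod_double (f : nat -> \bar R) n : (\prod_(i < n.*2) f i =
  \prod_(i < n) f i.*2 * \prod_(i < n) f i.*2.+1)%E.
Proof.
elim: n => [|n IHn]; first by rewrite !big_ord0 mule1.
by rewrite doubleS !big_ord_recr /= IHn -muleA muleACA.
Qed.

Lemma theta_inv_rect n (A : nat -> set R) :
  (fun w : borel_cube R * borel_cube R => theta_inv w.1 w.2) @^-1`
    rect n.*2 A =
  rect n (A \o double) `*` rect n (A \o (fun i => i.*2.+1)).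
Proof.
apply/seteqP; split => -[w w'] /=.
- move=> wA; split => i ni.
  + by have := wA i.*2; rewrite ltn_double /theta_inv odd_double doubleK; apply.
  + have := wA i.*2.+1; rewrite ltn_Sdouble /theta_inv /= odd_double /=.
    by rewrite uphalf_double; apply.
- move=> [wA w'A] i ni; rewrite /theta_inv.
  have hi : (i./2 < n)%N by rewrite ltn_half_double.
  rewrite -[i in A i](odd_double_half i); case: (odd i).
  + exact: w'A.
  + exact: wA.
Qed.

Variables (U : probability (Omega R) R) (hU : is_uniform U).

Definition borel_part : probability (borel_cube R) R :=
  image_prob U (@measurable_univ_borel R).

Lemma borel_part_rect n A : (forall i, measurable (A i)) ->
  borel_part (rect n A) = (\prod_(i < n) uniform_prob (@ltr01 R) (A i))%E.
Proof. exact: hU. Qed.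

(** Both sides are probability measures, hence it suffices to compare them on the
    pi-system of rectangles. Padding a rectangle to an even number of
    coordinates makes it the interleaving of two rectangles, and there both
    sides are products of the same factors. *)
Lemma uniform_interleave (A : set (borel_cube R)) : measurable A ->
  image_prob (product_prob borel_part borel_part)
    (@measurable_theta_inv_pair R) A = borel_part A.
Proof.
apply: (@measure_unique _ _ _ rects (fun=> setT)).
- exact: measurable_rectsE.
- exact: rects_setI.
- by move=> _; exists 0%N, (fun=> setT); split => //; apply/seteqP; split.
- by rewrite bigcup_const//; exists 0%N.
- move=> _ [n [B [mB ->]]].
  have nn : (n <= n.*2)%N by rewrite -addnn leq_addr.
  pose B' i := if (i < n)%N then B i else setT.
  rewrite (rect_widen B nn) -/B'.
  have mB' i : measurable (B' i) by rewrite /B'; case: ifP.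
  rewrite [LHS]image_probE theta_inv_rect.
  transitivity (borel_part (rect n (B' \o double)) *
                borel_part (rect n (B' \o (fun i => i.*2.+1))))%E.
    by apply: product_measure1E; apply: measurable_rect => i; exact: mB'.
  transitivity (\prod_(i < n.*2) uniform_prob (@ltr01 R) (B' i))%E.
    rewrite (prod_double (fun i => uniform_prob (@ltr01 R) (B' i))).
    by rewrite !borel_part_rect// => i; exact: mB'.
  by apply/esym/borel_part_rect.
- by move=> _; rewrite [ltLHS]probability_setT ltry.
Qed.

End uniform_interleaving.

(** * Sections of universally measurable sets *)

Section univ_sections.
Variables (R : realType) (U : probability (Omega R) R).

Let interleave (w : borel_cube R * borel_cube R) : borel_cube R :=
  theta_inv w.1 w.2.

Let xsection_interleave (A : set (borel_cube R)) (w : borel_cube R) :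
  xsection (interleave @^-1` A) w = theta_inv w @^-1` A.
Proof. by apply/seteqP; split => w' /=; rewrite xsectionP. Qed.

Let measurable_interleave A : measurable A -> measurable (interleave @^-1` A).
Proof.
move=> mA; rewrite -[X in measurable X]setTI.
exact: (@measurable_theta_inv_pair R).
Qed.

Lemma measurable_section_borel (A : set (borel_cube R)) : measurable A ->
  measurable_fun setT (fun w : borel_cube R =>
    borel_part U (theta_inv w @^-1` A)).
Proof.
move=> mA.
have := measurable_fun_xsection (borel_part U) (measurable_interleave mA).
by congr (measurable_fun _ _); apply/funext => w /=; rewrite xsection_interleave.
Qed.

Lemma measurable_theta_inv_preimage (A : set (Omega R)) (w : Omega R) :
  measurable A -> measurable (theta_inv w @^-1` A).
Proof.
by move=> mA; rewrite -[X in measurable X]setTI; exact: measurable_theta_inv.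
Qed.

(** Universal measurability of [A] is used for one measure, the image under
    interleaving of the product of [mu] and [U]. By Tonelli the sections of
    [C `\` B] are null sets outside a [mu]-null set [N], and there the sections
    of [A] and [B] have the same measure. *)
Lemma univ_section_bracket (mu : probability (borel_cube R) R)
    (A : set (Omega R)) : measurable A ->
  exists B C N : set (borel_cube R),
  [/\ [/\ measurable B, measurable C & measurable N],
      B `<=` A, A `<=` C,
      image_prob (product_prob mu (borel_part U))
        (@measurable_theta_inv_pair R) (C `\` B) = 0%E &
      mu N = 0%E /\ forall w, ~ N w ->
        U (theta_inv w @^-1` A) = borel_part U (theta_inv w @^-1` B)].
Proof.
move=> mA.
have := mA; rewrite measurable_OmegaE.
move=> /(_ (image_prob (product_prob mu (borel_part U))
                       (@measurable_theta_inv_pair R))).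
move=> [B [C [mB mC BA AC CB0]]].
have mCB : measurable (C `\` B) by exact: measurableD.
have msec := measurable_section_borel mCB.
have : (\int[mu]_w `| borel_part U (theta_inv w @^-1` (C `\` B)) | = 0)%E.
  rewrite -[RHS]CB0; apply: eq_integral => w _.
  by rewrite gee0_abs//= xsection_interleave.
move/(ae_eq_integral_abs mu measurableT msec) => [N [mN N0 subN]].
exists B, C, N; split => //; split => // w Nw.
have mU (D : set (borel_cube R)) : measurable D ->
    measurable (theta_inv w @^-1` D : set (Omega R)).
  move=> mD; apply: measurable_theta_inv_preimage.
  rewrite -[X in measurable X]setTI.
  exact: (@measurable_univ_borel R).
have CB0w : U (theta_inv w @^-1` (C `\` B)) = 0%E.
  by apply/not_notP => h; apply/Nw/subN => /(_ I).
change (borel_part U (theta_inv w @^-1` B)) with (U (theta_inv w @^-1` B)).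
apply/eqP; rewrite eq_le; apply/andP; split; last first.
  apply: le_measure; rewrite ?inE; [exact: mU|
    exact: measurable_theta_inv_preimage|exact: preimage_subset].
rewrite -[leRHS]adde0 -CB0w.
have mUB := mU _ mB; have mUD := mU _ mCB.
apply: (@le_trans _ _ (U (theta_inv w @^-1` B `|`
                          theta_inv w @^-1` (C `\` B)))).
  apply: le_measure; rewrite ?inE; [
    exact: measurable_theta_inv_preimage|exact: measurableU|].
  move=> w' /AC Cw'; have [Bw'|nBw'] := pselect (B (theta_inv w w')).
    by left.
  by right.
exact: measureU2.
Qed.

(** The kernel [w |-> U (A_w)] agrees outside a [mu]-null set with a Borel
    function; as [mu] is arbitrary it is universally measurable. *)
Lemma measurable_section (A : set (Omega R)) : measurable A ->
  measurable_fun setT (fun w : Omega R => U (theta_inv w @^-1` A)).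
Proof.
move=> mA _ D mD; rewrite setTI measurable_OmegaE => mu.
have [B [C [N [[mB mC mN] BA AC _ [N0 NE]]]]] := univ_section_bracket mu mA.
pose E := (fun w : borel_cube R => borel_part U (theta_inv w @^-1` B)) @^-1` D.
have mE : measurable E.
  rewrite -[X in measurable X]setTI.
  exact: (measurable_section_borel mB).
exists (E `\` N), (E `|` N); split.
- exact: measurableD.
- exact: measurableU.
- by move=> w [Ew Nw] /=; rewrite NE.
- move=> w /= Dw; have [Nw|nNw] := pselect (N w); first by right.
  by left; rewrite /E /= -NE.
- apply: (subset_measure0 _ mN _ N0).
    by apply: measurableD; [exact: measurableU|exact: measurableD].
  by move=> w [[Ew|//] nEN]; apply: contrapT => Nw; exact: nEN.
Qed.

Hypothesis hU : is_uniform U.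

(** Apply the bracket with [mu] the Borel part of [U] itself: the image of the
    product is then [U], so that [A] and its Borel core [B] have the same
    measure, and the identity for [B] is [uniform_interleave]. *)
Lemma uniform_disintegration (A : set (Omega R)) : measurable A ->
  U A = (\int[U]_w U (theta_inv w @^-1` A))%E.
Proof.
move=> mA.
have [B [C [N [[mB mC mN] BA AC CB0 [N0 NE]]]]] :=
  univ_section_bracket (borel_part U) mA.
have mUO (D : set (borel_cube R)) : measurable D -> measurable (D : set (Omega R)).
  move=> mD; rewrite -[X in measurable X]setTI.
  exact: (@measurable_univ_borel R).
have mCB : measurable (C `\` B) by exact: measurableD.
have UAB : U A = borel_part U B.
  change (borel_part U B) with (U B).
  apply/eqP; rewrite eq_le; apply/andP; split; last first.
    by apply: le_measure; rewrite ?inE//; exact: mUO.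
  rewrite uniform_interleave// in CB0.
  rewrite -[leRHS]adde0 -CB0.
  apply: (@le_trans _ _ (U (B `|` (C `\` B)))); last first.
    by apply: measureU2; exact: mUO.
  apply: le_measure; rewrite ?inE//.
    by apply: measurableU; exact: mUO.
  by move=> w /AC Cw; have [Bw|nBw] := pselect (B w); [left|right].
rewrite UAB -uniform_interleave// image_probE.
transitivity (\int[borel_part U]_w borel_part U (theta_inv w @^-1` B))%E.
  by apply: eq_integral => w _ /=; rewrite xsection_interleave.
rewrite ge0_integral_image_prob//; last exact: measurable_section_borel.
apply: ge0_ae_eq_integral => //.
- have := measurableT_comp (measurable_section_borel mB)
            (@measurable_univ_borel R).
  exact.
- exact: measurable_section.
- exists N; split => //; first exact: mUO.
  by move=> w /= h; apply: contrapT => Nw; apply: h => _; rewrite NE.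
Qed.

End univ_sections.

(** * Morphisms of the site and plots *)

Section site_morphisms.
Variable R : realType.

Lemma Ck_cst m n k (c : 'rV[R]_n) : Ck k (fun _ : 'rV[R]_m => c).
Proof.
elim: k c => [|k IHk] c; (split; first exact: cst_continuous) => // i.
split=> [x|]; first exact: derivable_cst.
rewrite (_ : (fun x => 'D_(delta_mx 0 i) (fun=> c) x) = fun=> 0);
  first exact: IHk.
by apply/funext => x; exact: derive_cst.
Qed.

Lemma Ck_id n k : Ck k (fun x : 'rV[R]_n => x).
Proof.
case: k => [|k]; (split; first by move=> x; exact: cvg_id) => // i.
split=> [x|]; first exact: derivable_id.
rewrite (_ : (fun x => 'D_(delta_mx 0 i) id x) = fun=> delta_mx 0 i);
  first exact: Ck_cst.
by apply/funext => x; exact: derive_id.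
Qed.

Lemma measurable_Prop (P : Prop) : measurable [set _ : Omega R | P].
Proof.
have [p|np] := pselect P.
- by rewrite (_ : mkset _ = setT)//; apply/seteqP; split.
- by rewrite (_ : mkset _ = set0)//; apply/seteqP; split.
Qed.

Lemma site_mor_base_cst m n (t : 'rV[R]_n) :
  site_mor (fun u : Omegan R m => (t, u.2)).
Proof.
exists (fun=> t), id; split => //; split => [w k|s B _].
- exact: Ck_cst.
- exact: (measurable_Prop (B t)).
Qed.

Lemma site_mor_base_id n (Psi : Omega R -> Omega R) :
  measurable_fun setT Psi -> site_mor (fun u : Omegan R n => (u.1, Psi u.2)).
Proof.
move=> mPsi; exists fst, Psi; split => //; split => [w k|s B _].
- exact: Ck_id.
- exact: (measurable_Prop (B s)).
Qed.

Lemma site_mor_resample m n (h : Omegan R m -> Omegan R n)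
    (Psi : Omega R -> Omega R) :
  measurable_fun setT Psi -> site_mor h ->
  site_mor (fun u => h (u.1, Psi u.2)).
Proof.
move=> mPsi [g [Phi [[smg mg] mPhi ->]]].
exists (fun u => g (u.1, Psi u.2)), (Phi \o Psi); split => //; last first.
  exact: measurableT_comp.
split => [w|t B mB]; first exact: (smg (Psi w)).
rewrite (_ : mkset _ = Psi @^-1` [set w | B (g (t, w))])//.
by rewrite -[X in measurable X]setTI; apply: mPsi => //; exact: mg.
Qed.

Lemma plot_resample (X : SSS R) n (p : Omegan R n -> X)
    (Psi : Omega R -> Omega R) :
  measurable_fun setT Psi -> plot X p -> plot X (fun u => p (u.1, Psi u.2)).
Proof. by move=> mPsi Xp; exact: plot_comp Xp (site_mor_base_id _ mPsi). Qed.

Lemma rand_slice (X : SSS R) n (p : Omegan R n -> X) t :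
  plot X p -> rand X (fun w => p (t, w)).
Proof. by move=> Xp; exact: plot_comp Xp (site_mor_base_cst 0 t). Qed.

Lemma rand_resample (X : SSS R) (a : Omega R -> X) (Psi : Omega R -> Omega R) :
  measurable_fun setT Psi -> rand X a -> rand X (fun w => a (Psi w)).
Proof. by move=> mPsi Xa; exact: plot_resample mPsi Xa. Qed.

Lemma rand_plot0 (X : pre_space R) (p : Omegan R 0 -> X) :
  plot X p -> rand X (fun w => p (0, w)).
Proof.
move=> Xp; rewrite /rand /=.
rewrite (_ : (fun _ => _) = p)//.
by apply/funext => -[t w] /=; rewrite (thinmx0 t).
Qed.

End site_morphisms.

(** * Laws and their means *)

Section laws.
Variables (R : realType) (U : probability (Omega R) R).
Implicit Types (X Y : pre_space R).

Lemma onBE X (mu : set X -> \bar R) A : Bsets X A -> onB mu A = mu A.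
Proof. by move=> mA; rewrite /onB asboolT. Qed.

Lemma eq_onB X (mu nu : set X -> \bar R) :
  (forall A, Bsets X A -> mu A = nu A) -> onB mu = onB nu.
Proof.
by move=> mn; apply/funext => A; rewrite /onB; case: asboolP => // /mn.
Qed.

(** Random laws are described by a single random variable. The base [R^0] of the
    plots in question has only one point, so this holds without the closure
    axioms and therefore applies to spaces of measures. *)
Lemma rand_P_space X (c : Omega R -> P_space U X) :
  rand (P_space U X) c <-> exists2 T, rand X T &
    forall w, prob_val (c w) = law U (fun w' => T (theta_inv w w')).
Proof.
split=> [[p Xp cE]|[T XT cE]].
- by exists (fun w => p (0, w)); [exact: rand_plot0|move=> w; exact: (cE 0)].
- by exists (fun u => T u.2).
Qed.

Lemma Bsets_preimage_smooth X Y (f : X -> Y) (B : set Y) :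
  (forall a, rand X a -> rand Y (f \o a)) -> Bsets Y B ->
  Bsets X (f @^-1` B).
Proof. by move=> smf mB a /smf /mB. Qed.

Lemma image_meas_law X Y (f : X -> Y) (a : Omega R -> X) :
  (forall a, rand X a -> rand Y (f \o a)) ->
  image_meas (law U a) f = law U (f \o a).
Proof.
move=> smf; apply: eq_onB => B mB.
by rewrite /law onBE//; exact: Bsets_preimage_smooth.
Qed.

End laws.

(** A law extended by zero to all subsets is again a measure, so that the
    integrals defining means are genuine integrals against measures. *)
Section zero_extension.
Local Open Scope ereal_scope.
Context d (T : measurableType d) (R : realType).
Variable mu : {measure set T -> \bar R}.

Definition zero_ext (A : set T) : \bar R :=
  if `[< measurable A >] then mu A else 0.

Lemma zero_extE A : measurable A -> zero_ext A = mu A.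
Proof. by move=> mA; rewrite /zero_ext asboolT. Qed.

Let zero_ext0 : zero_ext set0 = 0.
Proof. by rewrite zero_extE. Qed.

Let zero_ext_ge0 A : 0 <= zero_ext A.
Proof. by rewrite /zero_ext; case: ifP. Qed.

Let zero_ext_sigma_additive : semi_sigma_additive zero_ext.
Proof.
move=> F mF tF mUF; rewrite zero_extE//.
rewrite (_ : (fun n => _) = fun n => \sum_(0 <= i < n) mu (F i)).
  exact: measure_semi_sigma_additive.
by apply/funext => n; apply: eq_bigr => i _; exact: zero_extE.
Qed.

HB.instance Definition _ := isMeasure.Build _ _ _ zero_ext
  zero_ext0 zero_ext_ge0 zero_ext_sigma_additive.

Lemma integral_zero_ext (f : T -> \bar R) :
  \int[zero_ext]_x f x = \int[mu]_x f x.
Proof. by apply: eq_measure_integral => A mA _; exact: zero_extE. Qed.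

End zero_extension.

Section mean_of_laws.
Variables (R : realType) (U : probability (Omega R) R) (hU : is_uniform U).

Lemma measurable_at_pointE (X : pre_space R) (x0 : X) (A : set (at_point x0)) :
  measurable A = Bsets X A.
Proof. by []. Qed.

(** Along a random law the evaluation at [C] becomes the measure of a section of
    a universally measurable set. *)
Lemma measurable_eval (X : pre_space R) (x0 : P_space U X) (C : set X) :
  Bsets X C ->
  measurable_fun setT (fun nu : at_point x0 => prob_val (nu : prob_on X) C).
Proof.
move=> mC _ D mD; rewrite setTI measurable_at_pointE => c /rand_P_space [T XT cE].
rewrite (_ : _ @^-1` _ =
    (fun w => U (theta_inv w @^-1` (T @^-1` C))) @^-1` D); last first.
  by apply/seteqP; split => w /=; rewrite cE /law onBE.
rewrite -[X in measurable X]setTI.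
by apply: measurable_section => //; exact: mC.
Qed.

(** Drawing [w], then a point from [c w], amounts to evaluating [T] at the
    interleaving of two independent uniform points, which is a uniform point. *)
Lemma mean_law (X : pre_space R) (Gamma : P_space U (P_space U X))
    (c : Omega R -> P_space U X) (T : Omega R -> X) :
  rand X T ->
  (forall w, prob_val (c w) = law U (fun w' => T (theta_inv w w'))) ->
  prob_val Gamma = law U c ->
  mean Gamma = law U T.
Proof.
move=> XT cE GE; apply: eq_onB => C mC.
set x0 := prob_point Gamma.
have mc : measurable_fun setT (c : Omega R -> at_point x0).
  move=> _ B; rewrite setTI measurable_at_pointE; apply.
  by apply/rand_P_space; exists T.
have -> : prob_val Gamma = zero_ext (image_prob U mc) by rewrite GE.
rewrite integral_zero_ext ge0_integral_image_prob; last 2 first.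
- exact: measurable_eval.
- move=> nu; rewrite /prob_val; case: (svalP nu) => a [P [_ ->]].
  by rewrite /law onBE.
rewrite [RHS]uniform_disintegration//; last exact: mC.
by apply: eq_integral => w _; rewrite cE /law onBE.
Qed.

End mean_of_laws.

(** * Product of a law with a point mass *)

Section dirac_product.
Variables (R : realType) (U : probability (Omega R) R) (X Y : SSS R).

Lemma rand_cst (W : SSS R) (x : W) : rand W (fun=> x).
Proof. exact: plot_cst. Qed.

Lemma Bsets_sectionl (C : set (prod_space X Y)) y :
  Bsets _ C -> Bsets X [set x | C (x, y)].
Proof.
move=> mC a Xa; apply: (mC (fun w => (a w, y))).
by split; [exact: Xa|exact: rand_cst].
Qed.

Lemma Bsets_sectionr (C : set (prod_space X Y)) x :
  Bsets _ C -> Bsets Y [set y | C (x, y)].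
Proof.
move=> mC b Yb; apply: (mC (fun w => (x, b w))).
by split; [exact: rand_cst|exact: Yb].
Qed.

Definition dirac_product (mu : set X -> \bar R) (y : Y) :
    set (prod_space X Y) -> \bar R :=
  onB (fun C : set (prod_space X Y) => mu [set x | C (x, y)]).

Lemma dirac_product_law (a : Omega R -> X) (y : Y) :
  dirac_product (law U a) y = law U (fun w => (a w, y) : prod_space X Y).
Proof.
by apply: eq_onB => C mC; rewrite /law onBE//; exact: Bsets_sectionl.
Qed.

(** When one factor is a point mass, the iterated integral collapses: for every
    [b] with law [dirac_at y] the inner integral is the indicator of the section
    at [y], and the outer one is the measure of that section. Hence the value
    does not depend on the representatives. *)
Lemma is_product_dirac (mu : P_space U X) (y : Y)
    (rho : P_space U (prod_space X Y)) :
  (exists2 a, rand X a & prob_val mu = law U a) ->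
  prob_val rho = dirac_product (prob_val mu) y ->
  is_product mu (dirac_at U y) rho.
Proof.
move=> [a0 Xa0 mua0] rhoE; split.
  exists a0, (fun=> y); split => //; first exact: rand_cst.
  apply: eq_onB => A _; rewrite indicE.
  case: (boolP (y \in A)) => [/set_mem Ay|/negP nAy].
    rewrite (_ : _ @^-1` A = setT) ?probability_setT//.
    by apply/seteqP; split.
  rewrite (_ : _ @^-1` A = set0) ?measure0//.
  by apply/seteqP; split => // w /= Ay; apply: nAy; exact/mem_set.
move=> a b [Xa Yb muE dE] C mC.
rewrite rhoE /dirac_product onBE// muE /law onBE; last exact: Bsets_sectionl.
have mCy := Bsets_sectionl y mC.
transitivity (\int[U]_w1 (\1_(a @^-1` [set x | C (x, y)]) w1)%:E)%E.
  by rewrite integral_indic ?setIT//; exact: mCy.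
apply: eq_integral => w1 _; have mCa := Bsets_sectionr (a w1) mC.
transitivity (\int[U]_w2 (\1_(b @^-1` [set y' | C (a w1, y')]) w2)%:E)%E.
  rewrite integral_indic ?setIT//; last exact: mCa.
  have := congr1 (@^~ [set y' | C (a w1, y')]) dE.
  by rewrite /= /law !onBE// => <-.
apply: eq_integral => w2 _; rewrite !indicE.
by congr ((nat_of_bool _)%:R%:E); apply/idP/idP; rewrite !inE.
Qed.

End dirac_product.

(** * The product of Markov kernels *)

Section smooth_kernels.
Variables (R : realType) (U : probability (Omega R) R).

Lemma rand_smooth (X Y : pre_space R) (f : X -> Y) (a : Omega R -> X) :
  sample_smooth f -> rand X a -> rand Y (f \o a).
Proof. by move=> smf Xa; exact: smf. Qed.

(** An element of the space of measures is the law of a random point under some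
    probability [P]. The values of a smooth kernel are laws under [U]: the
    constant family at [x] is sent to a plot, and the plots of the space of
    measures are given by laws under [U]. *)
Lemma smooth_kernel_law (W : pre_space R) (X : SSS R)
    (f : W -> P_space U X) (x : W) :
  sample_smooth f -> rand W (fun=> x) ->
  exists2 a, rand X a & prob_val (f x) = law U a.
Proof.
move=> smf Wx; have /rand_P_space [T XT TE] := rand_smooth smf Wx.
exists (fun w' => T (theta_inv point w')); last exact: (TE point).
exact: rand_resample (@measurable_theta_inv R point) XT.
Qed.

End smooth_kernels.

Section kernel_product.
Variables (R : realType) (U : probability (Omega R) R) (hU : is_uniform U).
Variables (X Y Z : SSS R).
Implicit Types (K : smooth_map (prod_space Y Z) (P_space U X))
  (Q : smooth_map Z (P_space U Y)).

Lemma kernel_at_law K y z :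
  exists2 a, rand X a & prob_val (K (y, z)) = law U a.
Proof.
apply: (@smooth_kernel_law _ U (prod_space Y Z) X K (y, z) (svalP K)).
by split; exact: rand_cst.
Qed.

Lemma kernel_dirac_subproof K z y : exists a (P : probability (Omega R) R),
  rand (prod_space X Y) a /\ dirac_product (prob_val (K (y, z))) y = law P a.
Proof.
have [a Xa ->] := kernel_at_law K y z.
exists (fun w => (a w, y)), U; split; last exact: dirac_product_law.
by split; [exact: Xa|exact: rand_cst].
Qed.

Definition kernel_dirac K z (y : Y) : P_space U (prod_space X Y) :=
  exist _ _ (kernel_dirac_subproof K z y).

Definition interleaved_pair (b : Omega R -> Y) (T : Omega R -> X)
    (v : Omega R) : prod_space X Y :=
  (T v, b (theta1 v)).
Arguments interleaved_pair : clear implicits.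

Lemma rand_interleaved_pair b T : rand Y b -> rand X T ->
  rand (prod_space X Y) (interleaved_pair b T).
Proof.
by move=> Yb XT; split; [exact: XT|exact: rand_resample (@measurable_theta1 R) Yb].
Qed.

Lemma kernel_dirac_law K z b T w :
  prob_val (K (b w, z)) = law U (fun w' => T (theta_inv w w')) ->
  prob_val (kernel_dirac K z (b w)) =
  law U (fun w' => interleaved_pair b T (theta_inv w w')).
Proof.
move=> KE; rewrite [LHS]/= KE dirac_product_law; congr (law U _).
apply/funext => w'; rewrite /interleaved_pair.
by have [-> _] := theta_invK w w'.
Qed.

Lemma rand_kernel_dirac K z b : rand Y b ->
  rand (P_space U (prod_space X Y)) (kernel_dirac K z \o b).
Proof.
move=> Yb.
have /rand_P_space [T XT TE] : rand (P_space U X) (fun w => K (b w, z)).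
  apply: (rand_smooth (svalP K)); split; [exact: Yb|exact: rand_cst].
apply/rand_P_space; exists (interleaved_pair b T).
  exact: rand_interleaved_pair.
by move=> w; exact: kernel_dirac_law.
Qed.

Lemma kernel_image_law K z b : rand Y b ->
  image_meas (law U b) (kernel_dirac K z) = law U (kernel_dirac K z \o b).
Proof. by move=> Yb; apply: image_meas_law => a; exact: rand_kernel_dirac. Qed.

Lemma kernel_image_subproof K Q z : exists a (P : probability (Omega R) R),
  rand (P_space U (prod_space X Y)) a /\
  image_meas (prob_val (Q z)) (kernel_dirac K z) = law P a.
Proof.
have [b Yb ->] := smooth_kernel_law (svalP Q) (rand_cst z).
exists (kernel_dirac K z \o b), U; split; first exact: rand_kernel_dirac.
exact: kernel_image_law.
Qed.

Definition kernel_image K Q z : P_space U (P_space U (prod_space X Y)) :=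
  exist _ _ (kernel_image_subproof K Q z).

(** The pushforward of [Q z] is the law of the random law [kernel_dirac K z \o b],
    and its value at [w] is the law of the section at [w] of the interleaved
    pair; so [mean_law] applies. *)
Lemma mean_kernel_image K Q z b T : rand Y b -> rand X T ->
  prob_val (Q z) = law U b ->
  (forall w, prob_val (K (b w, z)) = law U (fun w' => T (theta_inv w w'))) ->
  mean (kernel_image K Q z) = law U (interleaved_pair b T).
Proof.
move=> Yb XT QE KE.
apply: (mean_law hU (c := kernel_dirac K z \o b)).
- exact: rand_interleaved_pair.
- by move=> w; exact: kernel_dirac_law.
- by rewrite [LHS]/= QE kernel_image_law.
Qed.

Lemma kernel_product_subproof K Q z : exists a (P : probability (Omega R) R),
  rand (prod_space X Y) a /\ mean (kernel_image K Q z) = law P a.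
Proof.
have [b Yb QE] := smooth_kernel_law (svalP Q) (rand_cst z).
have /rand_P_space [T XT TE] : rand (P_space U X) (fun w => K (b w, z)).
  apply: (rand_smooth (svalP K)); split; [exact: Yb|exact: rand_cst].
exists (interleaved_pair b T), U; split; first exact: rand_interleaved_pair.
exact: mean_kernel_image.
Qed.

Definition kernel_product_val K Q z : P_space U (prod_space X Y) :=
  exist _ _ (kernel_product_subproof K Q z).

Lemma kernel_product_valP K Q z :
  kernel_product_at K Q z (kernel_product_val K Q z).
Proof.
exists (kernel_dirac K z), (kernel_image K Q z); split => // y.
by apply: is_product_dirac => //; exact: kernel_at_law.
Qed.

(** Drawing [y] consumes fresh randomness. Along a plot [V] that represents
    [G u (q u)] a sample point thus consists of the sample point [theta1 u.2] of
    the original family and the randomness of [y]; this is why [F] and [q] are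
    evaluated at [theta1 u.2] in the second hypothesis while [V] is evaluated at
    [u]. *)
Lemma plot_kernel_product n
    (F : Omegan R n -> smooth_map (prod_space Y Z) (P_space U X))
    (G : Omegan R n -> smooth_map Z (P_space U Y)) (q : Omegan R n -> Z) :
  plot (P_space U Y) (fun u => G u (q u)) ->
  (forall V : Omegan R n -> Y, plot Y V ->
     plot (P_space U X) (fun u =>
       F (u.1, theta1 u.2) (V u, q (u.1, theta1 u.2)))) ->
  plot (P_space U (prod_space X Y))
    (fun u => kernel_product_val (F u) (G u) (q u)).
Proof.
move=> [V YV VE] /(_ V YV) [W XW WE].
(* Three independent uniform points are read off one: [theta1 u] is the sample
   point of the plot, [theta1 (theta2 u)] drives [Y] and [theta2 (theta2 u)]
   drives [X]. *)
pose tau (u : Omega R) : Omega R := theta_inv (theta1 u) (theta1 (theta2 u)).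
pose sigma (u : Omega R) : Omega R := theta_inv (tau u) (theta2 (theta2 u)).
have mtau : measurable_fun setT tau.
  have := @measurable_reindex R
    (fun n => if odd n then (n./2).*2.*2.+1 else (n./2).*2).
  congr (measurable_fun _ _); apply/funext => u; apply/funext => k.
  by rewrite /tau /theta_inv /theta1 /theta2; case: ifP.
have msigma : measurable_fun setT sigma.
  have := @measurable_reindex R
    (fun n => if odd n then (n./2).*2.+1.*2.+1 else
      let k := n./2 in if odd k then (k./2).*2.*2.+1 else (k./2).*2).
  congr (measurable_fun _ _); apply/funext => u; apply/funext => k.
  rewrite /sigma /tau /theta_inv /theta1 /theta2; case: ifP => //= _.
  by case: ifP.
exists (fun u => (W (u.1, sigma u.2), V (u.1, tau u.2)) : prod_space X Y).
  by split; [exact: plot_resample msigma XW|exact: plot_resample mtau YV].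
move=> t w.
pose b w' := V (t, theta_inv w w').
pose T v := W (t, theta_inv (theta_inv w (theta1 v)) (theta2 v)).
have theta1K (w1 w2 : Omega R) : theta1 (theta_inv w1 w2) = w1.
  by have [] := theta_invK w1 w2.
have theta2K (w1 w2 : Omega R) : theta2 (theta_inv w1 w2) = w2.
  by have [] := theta_invK w1 w2.
have TE v : T v = W (t, sigma (theta_inv w v)).
  by rewrite /T /sigma /tau !theta1K !theta2K.
rewrite [LHS](@mean_kernel_image _ _ _ b T).
- congr (law U _); apply/funext => v.
  by rewrite /interleaved_pair TE /= /tau theta1K theta2K.
- exact: rand_resample (@measurable_theta_inv R w) (rand_slice t YV).
- rewrite (_ : T = fun v => W (t, sigma (theta_inv w v))); last exact/funext.
  have := measurableT_comp msigma (@measurable_theta_inv R w).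
  by move=> m; exact: rand_resample m (rand_slice t XW).
- exact: VE.
- move=> w'; have := WE t (theta_inv w w'); rewrite /= theta1K => ->.
  by congr (law U _); apply/funext => v; rewrite /T theta1K theta2K.
Qed.

Lemma kernel_product_smooth K Q : sample_smooth (kernel_product_val K Q).
Proof.
move=> n q Zq; apply: (@plot_kernel_product n (fun=> K) (fun=> Q) q).
- exact: (svalP Q).
- move=> V YV; apply: (svalP K); split; first exact: YV.
  exact: plot_resample (@measurable_theta1 R) Zq.
Qed.

Definition kernel_product
    (KQ : prod_space (fun_space (prod_space Y Z) (P_space U X))
                     (fun_space Z (P_space U Y))) :
    fun_space Z (P_space U (prod_space X Y)) :=
  exist _ _ (kernel_product_smooth KQ.1 KQ.2).

(** A plot of a function space is tested against an arbitrary morphism [h] of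
    the site; the kernel [F] is evaluated at [h] precomposed with [theta1],
    which is again such a morphism. *)
Lemma kernel_product_sample_smooth : sample_smooth kernel_product.
Proof.
move=> n p [Fp Gp] m h q mh Zq.
apply: (plot_kernel_product (F := fun u => (p (h u)).1)
                            (G := fun u => (p (h u)).2)).
- exact: Gp.
- move=> V YV.
  apply: (Fp m (fun u => h (u.1, theta1 u.2))
               (fun u => (V u, q (u.1, theta1 u.2)))).
  + exact: site_mor_resample (@measurable_theta1 R) mh.
  + split; first exact: YV.
    exact: plot_resample (@measurable_theta1 R) Zq.
Qed.

End kernel_product.


Theorem theorem6p13 (R : realType) (U : probability (Omega R) R)
    (hU : is_uniform U) (X Y Z : SSS R) :
  exists kprod :
    prod_space (fun_space (prod_space Y Z) (P_space U X))
               (fun_space Z (P_space U Y)) ->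
    fun_space Z (P_space U (prod_space X Y)),
    (forall (K : smooth_map (prod_space Y Z) (P_space U X))
            (Q : smooth_map Z (P_space U Y)) (z : Z),
       kernel_product_at K Q z ((kprod (K, Q) : smooth_map _ _) z)) /\
    sample_smooth kprod.
Proof.
exists (@kernel_product R U hU X Y Z); split.
- by move=> K Q z; exact: kernel_product_valP.
- exact: kernel_product_sample_smooth.
Qed.
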